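(* Let $\nu$ be a Lévy measure on $\mathbb R$, with associated indices $\alpha_0$ and $\beta$ (defined in the context). Then $\alpha_0\le\beta$. If moreover $\nu$ admits a density $p$, $\nu(dx)=p(x)\,dx$, such that the limit $$\lim_{x\to0}|x|^{1+\gamma}p(x)$$ exists in $[0,+\infty]$ for all real $\gamma<\beta$, then $\alpha_0=\beta$.
   Context: A Lévy measure is a Borel measure $\nu$ on $\mathbb R$ with $\nu(\{0\})=0$ and $\int_{\mathbb R}(x^2\wedge1)\,\nu(dx)<\infty$. Its Blumenthal-Getoor index is $$\beta=\inf\Big\{\gamma>0:\ \int_{[-1,1]}|x|^\gamma\,\nu(dx)<\infty\Big\}.$$ The edge parameter is $$\alpha_0=\sup\Big\{\alpha\in(0,2):\ \liminf_{\eta\to0^+}\frac{\int_{[-\eta,\eta]}x^2\,\nu(dx)}{\eta^{2-\alpha}}>0\Big\},$$ with the convention $\sup\emptyset=0$. *)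

(* Defs.v *)
From HB Require Import structures.
From mathcomp Require Import all_boot all_order all_algebra.
From mathcomp Require Import all_classical all_reals all_analysis.

Set Implicit Arguments.
Unset Strict Implicit.
Unset Printing Implicit Defensive.

Import Order.TTheory GRing.Theory Num.Theory.
Import numFieldNormedType.Exports.

Local Open Scope classical_set_scope.
Local Open Scope ring_scope.

Definition levy_measure (R : realType)
    (nu : {measure set (measurableTypeR R) -> \bar R}) : Prop :=
  nu [set 0] = 0%E /\
  (\int[nu]_x (Num.min (x ^+ 2) 1)%:E < +oo)%E.

(* [inf] is the real-valued infimum. For a Levy measure the set is bounded
   below by 0 and contains 2, so this is the true infimum, in [0, 2]. *)
Definition blumenthal_getoor (R : realType)
    (nu : {measure set (measurableTypeR R) -> \bar R}) : R :=
  inf [set gamma : R | 0 < gamma /\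
    (\int[nu]_(x in `[(-1)%R, 1%R]) (`|x| `^ gamma)%:E < +oo)%E].

(* [sup] is the real-valued supremum. The set is bounded above by 2, and the
   convention sup set0 = 0 is that of the library (lemma [sup0]). *)
Definition edge_parameter (R : realType)
    (nu : {measure set (measurableTypeR R) -> \bar R}) : R :=
  sup [set alpha : R | 0 < alpha < 2 /\
    (0 < limf_einf (fun eta : R =>
       (\int[nu]_(x in `[(- eta)%R, eta]) (x ^+ 2)%:E) /
         (eta `^ (2 - alpha))%:E) 0%R^'+)%E].

Definition has_density (R : realType)
    (nu : {measure set (measurableTypeR R) -> \bar R}) (p : R -> R) : Prop :=
  [/\ measurable_fun [set: measurableTypeR R] p,
      forall x, 0 <= p x &
      forall A : set (measurableTypeR R), measurable A ->
        nu A = (\int[lebesgue_measure]_(x in A) (p x)%:E)%E].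

(* Main.v *)
Require Import Defs.
From HB Require Import structures.
From mathcomp Require Import all_boot all_order all_algebra.
From mathcomp Require Import all_classical all_reals all_analysis.
From mathcomp Require Import measurable_realfun ring lra.

Set Implicit Arguments.
Unset Strict Implicit.
Unset Printing Implicit Defensive.

Import Order.TTheory GRing.Theory Num.Theory.
Import numFieldNormedType.Exports.

Local Open Scope classical_set_scope.
Local Open Scope ring_scope.

(** Write U(e) for the truncated second moment, the integral of x^2 over
    [-e, e], and I(h) for the integral of |x|^h over [-1, 1].

    The inequality. Since x^2 <= e^(2-g) |x|^g on [-e, e], finiteness of I(g)
    gives U(e) <= e^(2-g) I(g) ([truncated_second_moment_le]). If moreover
    U(e) >= c e^(2-a) for all small e > 0, then c <= e^(a-g) I(g), and letting
    e tend to 0 forces a <= g ([edge_exponent_le]). So each exponent in the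
    supremum defining the edge parameter is at most each exponent in the infimum
    defining the Blumenthal-Getoor index.

    The equality. If it failed, there would be some g > 0 strictly between the two
    indices; let l be the limit of |x|^(1+g) p(x) at 0.
    - If l > 0, then p(x) >= c |x|^(-1-g) near 0, so nu gives [e/2, e] a mass
      at least c e^(-g) / 2 ([density_mass_ge]). As x^2 >= e^2 / 4 there, U(e)
      is at least of order e^(2-g), and g is an admissible exponent for the
      edge parameter ([edge_exponent_of_mass]): a contradiction.
    - If l = 0, then p(x) <= |x|^(-1-g) near 0, so nu gives the annulus
      r/2 < |x| <= r a mass of order at most r^(-g) ([density_annulus_le]).
      For h > g, summing r^h r^(-g) over the dyadic scales r = d / 2^n gives a
      convergent geometric series, so I(h) is finite ([absolute_moment_fin]).
      Taking h between g and the Blumenthal-Getoor index is a contradiction.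

    In both cases the density matters only through the mass it gives to an
    interval or annulus at distance about r from 0, on which |x|^h is comparable to
    r^h. *)

(** * Positive lower limits and elementary integral bounds *)

Lemma limf_einf_gt0P (R : realType) (f : R -> \bar R) (F : set_system R)
    (FF : Filter F) :
  (0 < limf_einf f F)%E <->
  exists2 c : R, 0 < c & \forall x \near F, (c%:E <= f x)%E.
Proof.
rewrite limf_einfE; split => [/ereal_sup_gt[_ [V FV <-]]|[c c0 Fc]].
- move=> V0; have lbV x : V x -> (ereal_inf [set f x | x in V] <= f x)%E.
    by move=> Vx; apply: ge_ereal_inf; exists (f x) => //; exists x.
  move: V0 lbV; case: (ereal_inf _) => [c|_|//] => [c0 lbV|lbV].
    by exists c => //; apply: filterS FV.
  (* an infinite lower bound on V can be replaced by any positive real *)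
  exists 1 => //; apply: filterS FV => x /lbV.
  by rewrite leye_eq => /eqP ->; rewrite leey.
- apply: (@lt_le_trans _ _ c%:E); first by rewrite lte_fin.
  apply: le_trans (ereal_sup_ubound _); last first.
    by exists [set x | (c%:E <= f x)%E]; [exact: Fc|reflexivity].
  by apply: le_ereal_inf_tmp => _ [x cx <-].
Qed.

Section constant_bounds.
Context d (T : measurableType d) (R : realType).
Variables (mu : {measure set T -> \bar R}) (D : set T) (f : T -> \bar R).

Lemma ge0_le_integral_cst k :
  measurable D -> measurable_fun D f -> (forall x, D x -> 0 <= f x)%E ->
  (forall x, D x -> f x <= k%:E)%E -> (\int[mu]_(x in D) f x <= k%:E * mu D)%E.
Proof.
move=> mD mf f0 fk; rewrite -integral_cst//.
by apply: ge0_le_integral.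
Qed.

Lemma ge0_cst_le_integral k :
  measurable D -> measurable_fun D f -> 0 <= k ->
  (forall x, D x -> k%:E <= f x)%E -> (k%:E * mu D <= \int[mu]_(x in D) f x)%E.
Proof.
move=> mD mf k0 fk; rewrite -integral_cst//.
by apply: ge0_le_integral => // x _; rewrite lee_fin.
Qed.

End constant_bounds.

(** * Moments of a measure near the origin *)

Section one_measure.
Context {R : realType} (nu : {measure set (measurableTypeR R) -> \bar R}).
Implicit Types (a g c : R).

Lemma measurable_normr_powR (D : set (measurableTypeR R)) g :
  measurable_fun D (fun x : R => (`|x| `^ g)%:E).
Proof.
apply/measurable_EFinP; apply: measurable_funTS.
apply: (measurableT_comp (measurable_powR _)); exact: normr_measurable.
Qed.

Lemma measurable_sqr_EFin (D : set (measurableTypeR R)) :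
  measurable_fun D (fun x : R => (x ^+ 2)%:E).
Proof.
by apply/measurable_EFinP; apply: measurable_funTS; exact: measurable_funX.
Qed.

(** On [-1, 1] the truncation by 1 is inactive, so the Levy condition says that
    2 is an admissible exponent for the Blumenthal-Getoor index. *)
Lemma levy_sqr_fin : levy_measure nu ->
  (\int[nu]_(x in `[(-1)%R, 1%R]) (`|x| `^ 2)%:E < +oo)%E.
Proof.
move=> [_]; apply: le_lt_trans.
have mm (D : set (measurableTypeR R)) :
    measurable_fun D (fun x : R => (Num.min (x ^+ 2) 1)%:E).
  apply/measurable_EFinP; apply: measurable_funTS.
  by apply: measurable_minr => //; exact: measurable_funX.
have m0 (x : R) : (0 <= (Num.min (x ^+ 2) 1)%:E)%E.
  by rewrite lee_fin le_min sqr_ge0 ler01.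
apply: (@le_trans _ _
  (\int[nu]_(x in `[(-1)%R, 1%R]) (Num.min (x ^+ 2) 1)%:E)%E).
  apply: ge0_le_integral => //.
  - exact: measurable_normr_powR.
  move=> x /=; rewrite in_itv/= -ler_norml => x1.
  rewrite lee_fin powR_mulrn// real_normK ?num_real// le_min lexx/=.
  by rewrite -real_normK ?num_real// expr_le1.
by apply: ge0_subset_integral.
Qed.

(** On [-a, a], x^2 = |x|^(2-g) |x|^g and the first factor is at most a^(2-g). *)
Lemma truncated_second_moment_le a g :
  0 < a <= 1 -> g <= 2 ->
  (\int[nu]_(x in `[(- a)%R, a]) (x ^+ 2)%:E <=
   (a `^ (2 - g))%:E * \int[nu]_(x in `[(-1)%R, 1%R]) (`|x| `^ g)%:E)%E.
Proof.
move=> /andP[a0 a1] g2.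
apply: (@le_trans _ _ ((a `^ (2 - g))%:E *
    \int[nu]_(x in `[(- a)%R, a]) (`|x| `^ g)%:E)%E); last first.
  rewrite lee_wpmul2l ?lee_fin ?powR_ge0//.
  apply: ge0_subset_integral => //.
  - exact: measurable_normr_powR.
  by apply: subset_itv; rewrite bnd_simp// lerN2.
rewrite -ge0_integralZl_EFin ?powR_ge0//; last exact: measurable_normr_powR.
apply: ge0_le_integral => //.
- by move=> x _; rewrite lee_fin sqr_ge0.
- exact: measurable_sqr_EFin.
- apply: measurable_funeM; exact: measurable_normr_powR.
move=> x /=; rewrite in_itv/= -ler_norml => xa.
rewrite -EFinM lee_fin; have [->|x0] := eqVneq x 0.
  by rewrite expr0n/= mulr_ge0// powR_ge0.
rewrite -real_normK ?num_real// -powR_mulrn//.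
have -> : `|x| `^ 2 = `|x| `^ (2 - g) * `|x| `^ g.
  by rewrite -powRD ?subrK// normr_eq0 x0 implybT.
by rewrite ler_wpM2r ?powR_ge0// ge0_ler_powR ?subr_ge0 ?nnegrE ?(ltW a0).
Qed.

(** Combined with [truncated_second_moment_le], a positive lower limit c would give
    c <= e^(a-g) I(g) for all small e; if g < a the right side tends to 0. *)
Lemma edge_exponent_le a g : 0 < g -> 0 < a < 2 ->
  (\int[nu]_(x in `[(-1)%R, 1%R]) (`|x| `^ g)%:E < +oo)%E ->
  (0 < limf_einf (fun eta : R =>
       (\int[nu]_(x in `[(- eta)%R, eta]) (x ^+ 2)%:E) /
         (eta `^ (2 - a))%:E) 0%R^'+)%E -> a <= g.
Proof.
move=> g0 /andP[a0 a2] Ig /limf_einf_gt0P[c c0 near_c].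
rewrite leNgt; apply/negP => ga.
have [M M0 IM] : exists2 M : R, 0 <= M &
    (\int[nu]_(x in `[(-1)%R, 1%R]) (`|x| `^ g)%:E)%E = M%:E.
  have : (0 <= \int[nu]_(x in `[(-1)%R, 1%R]) (`|x| `^ g)%:E)%E.
    by apply: integral_ge0 => x _; rewrite lee_fin powR_ge0.
  move: Ig; case: (integral _ _ _) => [M _ M0|//|//].
  by exists M.
(* M + 1 rather than M, which may vanish *)
have small : \forall e \near 0^'+, e `^ (a - g) < c / (M + 1).
  have ag0 : 0 < a - g by rewrite subr_gt0.
  apply: (cvgr_lt 0 (powR_cvg0 ag0)).
  by rewrite divr_gt0// ltr_wpDl.
have [e [[ce se] [e0 e1]]] : exists e : R, ((c%:E <=
    \int[nu]_(x in `[(- e)%R, e]) (x ^+ 2)%:E / (e `^ (2 - a))%:E)%E /\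
    e `^ (a - g) < c / (M + 1)) /\ (0 < e /\ e <= 1).
  apply: (@filter_ex _ (0 : R)^'+).
  apply: filterI; first exact: filterI.
  apply: filterI; [exact: nbhs_right_gt|exact: nbhs_right_le].
have ea0 : 0 < e `^ (2 - a) by rewrite powR_gt0.
move: ce; rewrite inver gt_eqF//= lee_pdivlMr// => ce.
have e01 : 0 < e <= 1 by rewrite e0 e1.
have g2 : g <= 2 by apply/ltW/(lt_trans ga).
have := le_trans ce (truncated_second_moment_le e01 g2).
rewrite IM -!EFinM lee_fin.
have -> : 2 - g = (2 - a) + (a - g) by ring.
rewrite (@powRD _ e (2 - a) (a - g)); last by rewrite (gt_eqF e0) implybT.
rewrite [c * _]mulrC -mulrA ler_pM2l// => cM.
move: se; rewrite ltr_pdivlMr ?ltr_wpDl// mulrDr mulr1 => se.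
have : e `^ (a - g) * M < c by apply: le_lt_trans se; rewrite lerDl powR_ge0.
by rewrite ltNge cM.
Qed.

(** * Dyadic annuli *)

(** Half-open, so that the annuli of radii d / 2^n tile 0 < |x| <= d. *)
Definition annulus (r : R) : set (measurableTypeR R) :=
  [set x : R | r / 2 < `|x| <= r].

Lemma measurable_annulus r : measurable (annulus r).
Proof.
have -> : annulus r = setT `&` (fun x : R => `|x|) @^-1` `]r / 2, r].
  by apply/seteqP; split=> x /=; rewrite in_itv/=; [split|case].
by apply: normr_measurable => //; exact: measurable_itv.
Qed.

(** On [e/2, e] one has x^2 >= e^2 / 4, so that part alone contributes at least
    (c/4) e^(2-g) to the truncated second moment. *)
Lemma edge_exponent_of_mass c g : 0 < c ->
  (\forall e \near 0^'+, ((c * e `^ (- g))%:E <= nu `[(e / 2)%R, e]%classic)%E) ->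
  (0 < limf_einf (fun eta : R =>
       (\int[nu]_(x in `[(- eta)%R, eta]) (x ^+ 2)%:E) /
         (eta `^ (2 - g))%:E) 0%R^'+)%E.
Proof.
move=> c0 nuge; apply/limf_einf_gt0P; exists (c / 4); first by rewrite divr_gt0.
near=> e.
have e0 : 0 < e by near: e; exact: nbhs_right_gt.
rewrite inver gt_eqF ?powR_gt0//= lee_pdivlMr ?powR_gt0//.
apply: (@le_trans _ _ (\int[nu]_(x in `[(e / 2)%R, e]) (x ^+ 2)%:E)%E); last first.
  apply: ge0_subset_integral => //.
  - exact: measurable_sqr_EFin.
  - by move=> x _; rewrite lee_fin sqr_ge0.
  - by apply: subset_itv; rewrite bnd_simp//; lra.
apply: (@le_trans _ _ (((e / 2) ^+ 2)%:E * nu `[(e / 2)%R, e]%classic)%E); last first.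
  apply: ge0_cst_le_integral => //; [exact: measurable_sqr_EFin|exact: sqr_ge0|].
  move=> x /=; rewrite in_itv/= => /andP[ex _]; rewrite lee_fin.
  by rewrite lerXn2r ?nnegrE//; lra.
apply: (@le_trans _ _ (((e / 2) ^+ 2)%:E * (c * e `^ (- g))%:E)%E); last first.
  rewrite lee_wpmul2l ?lee_fin ?sqr_ge0//.
  by near: e.
rewrite -!EFinM lee_fin powRD; last by rewrite (gt_eqF e0) implybT.
rewrite powR_mulrn ?(ltW e0)// le_eqVlt; apply/orP; left; apply/eqP; field.
Unshelve. all: by end_near. Qed.

Lemma nneseries_geometric_fin a (z : R) : 0 <= a -> 0 < z < 1 ->
  (\sum_(0 <= n <oo) (a * z ^+ n)%:E < +oo)%E.
Proof.
move=> a0 /andP[z0 z1].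
apply: (@le_lt_trans _ _ (a / (1 - z))%:E); last exact: ltry.
apply: lime_le.
  apply: is_cvg_nneseries => n _ _.
  by rewrite lee_fin mulr_ge0// exprn_ge0// ltW.
apply: nearW => n; rewrite sumEFin lee_fin.
by apply: geometric_le_lim => //; rewrite ger0_norm// ltW.
Qed.

Lemma dyadic_cover d x : 0 < d -> 0 < `|x| <= d ->
  exists n, annulus (d / 2 ^+ n) x.
Proof.
move=> d0 /andP[x0 xd].
have ex : exists n, d / 2 ^+ n < `|x|.
  have : \forall n \near \oo, `|d * (2^-1) ^+ n| < `|x|.
    have : geometric d (2^-1) n @[n --> \oo] --> (0 : R).
      by apply: cvg_geometric; rewrite ger0_norm ?invf_lt1 ?ltr1n.
    by move/cvgr0_norm_lt; apply.
  case=> n _ /(_ n (leqnn n)); rewrite exprVn => xn; exists n.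
  by apply: le_lt_trans xn; exact: ler_norm.
(* the least N with d / 2^N < |x| is positive; its predecessor is the scale of x *)
case: (ex_minnP ex) => -[|n] xn nmin.
  by move: xn; rewrite expr0 divr1 ltNge xd.
exists n; apply/andP; split.
  by rewrite -mulrA -invfM -exprSr.
by rewrite leNgt; apply/negP => /nmin; rewrite ltnn.
Qed.

Lemma dyadic_trivIset d : 0 < d ->
  trivIset setT (fun n => annulus (d / 2 ^+ n)).
Proof.
move=> d0; apply: ltn_trivIset => n m mn; apply/seteqP; split => // x [].
move=> /andP[xm _] /andP[_ xn].
have := lt_le_trans xm xn.
rewrite -mulrA -invfM -exprSr ltr_pM2l// ltf_pV2 ?posrE ?exprn_gt0//.
by rewrite ltNge ler_weXn2l ?ler1n.
Qed.

(** In the moment over 0 < |x| <= d, the annulus of radius r = d / 2^n contributes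
    at most r^h C r^(-g), a geometric sequence in n of ratio 2^(g-h) < 1. *)
Lemma absolute_moment_fin (C d g h : R) : 0 <= C -> 0 < d <= 1 -> 0 < h -> g < h ->
  (\int[nu]_(x in `[(-1)%R, 1%R]) (`|x| `^ 2)%:E < +oo)%E ->
  (forall r : R, (0 < r <= d)%R -> nu (annulus r) <= (C * r `^ (- g))%:E)%E ->
  (\int[nu]_(x in `[(-1)%R, 1%R]) (`|x| `^ h)%:E < +oo)%E.
Proof.
move=> C0 /andP[d0 d1] h0 gh I2 nuA.
pose A n := annulus (d / 2 ^+ n); pose D := \bigcup_n A n.
have rd n : 0 < d / 2 ^+ n <= d.
  rewrite divr_gt0 ?exprn_gt0//= ler_pdivrMr ?exprn_gt0//.
  by rewrite ler_pMr// exprn_ege1// ler1n.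
have mA n : measurable (A n) by exact: measurable_annulus.
have mD : measurable D by exact: bigcup_measurable.
have powr1 t : 1 = 1 `^ t :> R by rewrite powR1.
have f0 (x : R) : (0 <= (`|x| `^ h)%:E)%E by rewrite lee_fin powR_ge0.
have D1 : D `<=` `[(-1)%R, 1%R].
  move=> x [n _ /andP[_ xd]]; rewrite /= in_itv/= -ler_norml.
  by apply: (le_trans xd); case/andP: (rd n) => _ /le_trans; apply.
(* split [-1, 1] into the tiled part D and the rest: 0 and d < |x| <= 1 *)
rewrite -(setDUK D1) ge0_integral_setU//; last 3 first.
- exact: measurableD.
- exact: measurable_normr_powR.
- by apply/disj_setPS => x [? []].
apply: lte_add_pinfty.
- rewrite ge0_integral_bigcup//; last 2 first.
  + exact: measurable_normr_powR.
  + exact: dyadic_trivIset.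
  pose z : R := 2^-1 `^ (h - g).
  have z01 : 0 < z < 1.
    rewrite powR_gt0 ?invr_gt0//= [ltRHS](powr1 (h - g)).
    by rewrite gt0_ltr_powR ?subr_gt0 ?nnegrE// invf_lt1// ltr1n.
  apply: le_lt_trans (@nneseries_geometric_fin (C * d `^ (h - g)) z _ z01); last first.
    by rewrite mulr_ge0// powR_ge0.
  apply: lee_nneseries => [n _ _|n _]; first exact: integral_ge0.
  case/andP: (rd n) => r0 rled.
  set r := d / 2 ^+ n in r0 rled *.
  apply: (@le_trans _ _ ((r `^ h)%:E * nu (A n))%E).
    apply: ge0_le_integral_cst => //; first exact: measurable_normr_powR.
    move=> x /andP[_ xr].
    by rewrite lee_fin ge0_ler_powR ?nnegrE// ltW.
  apply: (@le_trans _ _ ((r `^ h)%:E * (C * r `^ (- g))%:E)%E).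
    by rewrite lee_wpmul2l ?lee_fin ?powR_ge0// nuA// r0.
  rewrite -EFinM lee_fin mulrCA -powRD; last by rewrite (gt_eqF r0) implybT.
  rewrite -mulrA ler_wpM2l// /r -exprVn powRM ?exprn_ge0 ?invr_ge0 ?(ltW d0)//.
  by rewrite -(@powR_mulrn _ 2^-1) ?invr_ge0// powRAC powR_mulrn ?powR_ge0.
- (* off D, |x|^h <= 1 <= d^-2 |x|^2 except at x = 0, where both sides vanish *)
  apply: (@le_lt_trans _ _ (\int[nu]_(x in `[(-1)%R, 1%R] `\` D)
    ((d ^- 2)%:E * (`|x| `^ 2)%:E))%E).
    apply: ge0_le_integral => //.
    + exact: measurableD.
    + exact: measurable_normr_powR.
    + apply: measurable_funeM; exact: measurable_normr_powR.
    move=> x [/=]; rewrite in_itv/= -ler_norml => x1 Dx.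
    rewrite -EFinM lee_fin; have [->|x0] := eqVneq x 0.
      rewrite normr0 powR0 ?gt_eqF// mulr_ge0 ?powR_ge0//.
      by rewrite invr_ge0 exprn_ge0// ltW.
    have dx : d <= `|x|.
      rewrite leNgt; apply/negP => xd; apply: Dx.
      have [||n nx] := @dyadic_cover d x; rewrite ?normr_gt0 ?x0 ?ltW//.
      by exists n.
    apply: (@le_trans _ _ 1).
      rewrite [leRHS](powr1 h) ge0_ler_powR ?nnegrE//; exact: ltW.
    rewrite powR_mulrn// mulrC ler_pdivlMr ?exprn_gt0// mul1r.
    by rewrite lerXn2r ?nnegrE// ltW.
  rewrite ge0_integralZl_EFin//; last 3 first.
  + exact: measurableD.
  + exact: measurable_normr_powR.
  + by rewrite invr_ge0 exprn_ge0// ltW.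
  rewrite lte_mul_pinfty ?lee_fin ?invr_ge0 ?exprn_ge0 ?(ltW d0)//.
  apply: le_lt_trans I2; apply: ge0_subset_integral => //.
  + exact: measurableD.
  + exact: measurable_normr_powR.
Qed.
End one_measure.

(** * Densities with power bounds at the origin *)

Section density.
Context {R : realType} (nu : {measure set (measurableTypeR R) -> \bar R}).
Variables (p : R -> R) (nup : has_density nu p).

(** An interval of length e/2 on which p(x) >= c x^(-(1+g)) >= c e^(-(1+g)). *)
Lemma density_mass_ge c g : 0 < c -> 0 <= g ->
  (\forall x \near 0^', c <= `|x| `^ (1 + g) * p x) ->
  \forall e \near 0^'+, ((c / 2 * e `^ (- g))%:E <= nu `[(e / 2)%R, e]%classic)%E.
Proof.
case: nup => mp p0 nuE c0 g0 /nbhs_ballP[d /= d0 cp].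
near=> e.
have e0 : 0 < e by near: e; exact: nbhs_right_gt.
have ed : e < d by near: e; exact: nbhs_right_lt.
rewrite nuE; last exact: measurable_itv.
apply: (@le_trans _ _ ((c * e `^ (- (1 + g)))%:E *
    lebesgue_measure (`[(e / 2)%R, e] : set (measurableTypeR R)))%E); last first.
  apply: ge0_cst_le_integral.
  - exact: measurable_itv.
  - apply/measurable_EFinP; exact: measurable_funTS.
  - by rewrite mulr_ge0 ?powR_ge0 ?ltW.
  move=> x /=; rewrite in_itv/= => /andP[ex xe].
  have x0 : 0 < x by lra.
  rewrite lee_fin powRN ler_pdivrMr ?powR_gt0// mulrC.
  have := cp x; rewrite /ball/= sub0r normrN gtr0_norm// => cpx.
  apply: le_trans (cpx _ _) _; [lra|by rewrite gt_eqF|].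
  by rewrite ler_wpM2r// ge0_ler_powR ?nnegrE; lra.
have e2e : e / 2 < e by lra.
rewrite lebesgue_measure_itv/= lte_fin e2e -EFinD -EFinM lee_fin.
rewrite opprD powRD; last by rewrite (gt_eqF e0) implybT.
rewrite powR_inv1 ?(ltW e0)// le_eqVlt; apply/orP; left; apply/eqP; field.
by rewrite gt_eqF.
Unshelve. all: by end_near. Qed.

(** The annulus lies in [-r, r], of length 2 r, and on it
    p(x) <= C |x|^(-(1+g)) <= C (r/2)^(-(1+g)). *)
Lemma density_annulus_le C g : 0 <= C -> 0 <= g ->
  (\forall x \near 0^', `|x| `^ (1 + g) * p x <= C) ->
  exists2 d : R, 0 < d <= 1 &
  forall r : R, 0 < r <= d ->
    (nu (annulus r) <= ((2 * C * 2 `^ (1 + g)) * r `^ (- g))%:E)%E.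
Proof.
case: nup => mp p0 nuE C0 g0 /nbhs_ballP[d /= d0 Cp].
(* d / 2, since the neighbourhood is an open ball while r <= d is allowed *)
exists (Num.min 1 (d / 2)); first by rewrite lt_min ltr01 ge_min lexx divr_gt0.
move=> r /andP[r0]; rewrite le_min => /andP[_ rd].
have mA : measurable (annulus r) by exact: measurable_annulus.
rewrite nuE//.
apply: (@le_trans _ _ ((C * (r / 2) `^ (- (1 + g)))%:E *
    lebesgue_measure (annulus r))%E).
  apply: ge0_le_integral_cst => //.
  - apply/measurable_EFinP; exact: measurable_funTS.
  - by move=> x _; rewrite lee_fin.
  - move=> x /andP[rx xr].
    have x0 : 0 < `|x| by lra.
    rewrite lee_fin powRN ler_pdivlMr ?powR_gt0 ?divr_gt0// mulrC.
    have := Cp x; rewrite /ball/= sub0r normrN => Cpx.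
    apply: le_trans (Cpx _ _); [|lra|by rewrite -normr_gt0].
    by rewrite ler_wpM2r// ge0_ler_powR ?nnegrE; lra.
apply: (@le_trans _ _ ((C * (r / 2) `^ (- (1 + g)))%:E * (2 * r)%:E)%E).
  rewrite lee_wpmul2l ?lee_fin ?mulr_ge0 ?powR_ge0//.
  apply: (@le_trans _ _ (lebesgue_measure (`[- r, r] : set (measurableTypeR R)))).
    apply: le_measure; rewrite ?inE//.
    by move=> x /andP[_ xr]; rewrite /= in_itv/= -ler_norml.
  rewrite lebesgue_measure_itv/= lte_fin gtrN// -EFinD lee_fin; lra.
rewrite -EFinM lee_fin powRM ?invr_ge0 ?(ltW r0)//.
have -> : 2^-1 `^ (- (1 + g)) = 2 `^ (1 + g) :> R.
  by rewrite -powR_inv1// -powRrM mulN1r opprK.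
rewrite opprD powRD; last by rewrite (gt_eqF r0) implybT.
rewrite powR_inv1 ?(ltW r0)// le_eqVlt; apply/orP; left; apply/eqP; field.
by rewrite gt_eqF.
Qed.
End density.

(** * Comparison of the two indices *)

Lemma edge_parameter_ge0 (R : realType)
    (nu : {measure set (measurableTypeR R) -> \bar R}) : 0 <= edge_parameter nu.
Proof.
rewrite /edge_parameter; set E := [set _ | _].
have [->|/set0P[a Ea]] := eqVneq E set0; first by rewrite sup0.
have : has_ubound E by exists 2 => b [/andP[_ /ltW]].
move/ub_le_sup => /(_ _ Ea); apply: le_trans.
by case: Ea => /andP[/ltW].
Qed.

Theorem proposition1 (R : realType)
    (nu : {measure set (measurableTypeR R) -> \bar R})
    (nu_levy : levy_measure nu) :
  edge_parameter nu <= blumenthal_getoor nu /\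
  (forall p : R -> R, has_density nu p ->
    (forall gamma : R, gamma < blumenthal_getoor nu ->
      exists l : \bar R, (0 <= l)%E /\
        (fun x : R => (`|x| `^ (1 + gamma) * p x)%:E) @ 0^' --> l) ->
    edge_parameter nu = blumenthal_getoor nu).
Proof.
have I2 := levy_sqr_fin nu_levy.
have bgle h : 0 < h ->
    (\int[nu]_(x in `[(-1)%R, 1%R]) (`|x| `^ h)%:E < +oo)%E ->
    blumenthal_getoor nu <= h.
  by move=> h0 Ih; apply: ge_inf => //; exists 0 => g [/ltW].
have edge_le : edge_parameter nu <= blumenthal_getoor nu.
  apply: lb_le_inf; first by exists 2; split.
  move=> g [g0 Ig]; rewrite /edge_parameter; set E := [set _ | _].
  have [->|/set0P E0] := eqVneq E set0; first by rewrite sup0 ltW.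
  by apply: ge_sup => // a [a02 Ea]; exact: edge_exponent_le Ea.
split=> // p nup plim; apply/eqP; rewrite eq_le edge_le leNgt/=.
apply/negP => edge_lt.
(* nonnegativity of the edge parameter makes the intermediate exponent g positive *)
have edge0 := edge_parameter_ge0 nu.
pose g := (edge_parameter nu + blumenthal_getoor nu) / 2.
have [g0 eg gb] : [/\ 0 < g, edge_parameter nu < g & g < blumenthal_getoor nu].
  by rewrite /g; split; lra.
have [l [l0 cvgl]] := plim g gb.
move: l0; rewrite le_eqVlt => /orP[/eqP l0|l0].
- have /(density_annulus_le nup ler01 (ltW g0))[d d01 nuA] :
      \forall x \near 0^', `|x| `^ (1 + g) * p x <= 1.
    have f_lt1 : \forall x \near 0^', ((`|x| `^ (1 + g) * p x)%:E < 1)%E.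
      apply: (cvgl [set y | (y < 1)%E]); apply: open_nbhs_nbhs.
      by split; [exact: open_ereal_lt_ereal|rewrite /= -l0 lte01].
    by apply: filterS f_lt1 => x; rewrite lte_fin => /ltW.
  pose h := (g + blumenthal_getoor nu) / 2.
  have [h0 gh hb] : [/\ 0 < h, g < h & h < blumenthal_getoor nu].
    by rewrite /h; split; lra.
  have C0 : 0 <= 2 * 1 * 2 `^ (1 + g) :> R by rewrite !mulr_ge0 ?powR_ge0.
  have := bgle h h0 (absolute_moment_fin C0 d01 h0 gh I2 nuA).
  by rewrite leNgt hb.
- have [c c0 cl] : exists2 c : R, 0 < c & (c%:E < l)%E.
    move: l0; case: (l) => [r| |//]; last by exists 1; rewrite ?ltry.
    by rewrite lte_fin => r0; exists (r / 2); rewrite ?lte_fin; lra.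
  have /(density_mass_ge nup c0 (ltW g0)) :
      \forall x \near 0^', c <= `|x| `^ (1 + g) * p x.
    have f_gtc : \forall x \near 0^', (c%:E < (`|x| `^ (1 + g) * p x)%:E)%E.
      apply: (cvgl [set y | (c%:E < y)%E]); apply: open_nbhs_nbhs.
      by split; [exact: open_ereal_gt_ereal|].
    by apply: filterS f_gtc => x; rewrite lte_fin => /ltW.
  move=> /(edge_exponent_of_mass (divr_gt0 c0 (ltr0Sn _ 1))) Eg.
  have : g <= edge_parameter nu.
    apply: ub_le_sup; first by exists 2 => b [/andP[_ /ltW]].
    split; last exact: Eg.
    by rewrite g0 (lt_le_trans gb)// bgle.
  by rewrite leNgt eg.
Qed.
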